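(* Let $(W,S)$ be an arbitrary Coxeter system and let $\underline{w}=(s_1,\ldots,s_n)$ be any expression (a finite sequence of elements of $S$, not necessarily reduced). Then there exists a sequence $\{c_i\}_{i=1}^n$ of real numbers with $c_i>0$ such that the following hold with respect to $\ell_n=\sum_{1\le i\le n}c_ix_i\in\overline{\mathrm{BS}}^1(\underline{w})$. (1) (Poincaré duality) For every non-negative integer $k\le n/2$, the bilinear pairing $$\overline{\mathrm{BS}}^k(\underline{w})\times\overline{\mathrm{BS}}^{n-k}(\underline{w})\to\mathbb{R},\qquad(\eta_1,\eta_2)\mapsto\deg(\eta_1\eta_2)$$ is non-degenerate, where the degree isomorphism $\deg:\overline{\mathrm{BS}}^n(\underline{w})\to\mathbb{R}$ is defined by taking the coefficient of the monomial $x_1x_2\cdots x_n$. (2) (Hard Lefschetz) For every non-negative integer $k\le n/2$, the multiplication map $$\overline{\mathrm{BS}}^k(\underline{w})\to\overline{\mathrm{BS}}^{n-k}(\underline{w}),\qquad\eta\mapsto\ell_n^{\,n-2k}\eta$$ is an isomorphism. (3) (Hodge--Riemann relations) For every non-negative integer $k\le n/2$, the bilinear form $$\overline{\mathrm{BS}}^k(\underline{w})\times\overline{\mathrm{BS}}^k(\underline{w})\to\mathbb{R},\qquad(\eta_1,\eta_2)\mapsto\deg(\ell_n^{\,n-2k}\eta_1\eta_2)$$ is $(-1)^k$-definite when restricted to the primitive subspace $P^k_{\ell_n}=\ker(\ell_n^{\,n-2k+1})\subset\overline{\mathrm{BS}}^k(\underline{w})$.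
   Context: A Coxeter system $(W,S)$ has $S$ finite, $W=\langle s\in S\mid (st)^{m_{st}}=\mathrm{id}\text{ for } s,t\in S,\ m_{st}<\infty\rangle$, with $m_{ss}=1$ and $m_{st}=m_{ts}\in\{2,3,\ldots\}\cup\{\infty\}$ for $s\ne t$. Convention: $\pi/m_{st}=0$ if $m_{st}=\infty$. Bott--Samelson ring (generators and relations): let $\tilde R_{\underline{w}}=(\tilde r_{ij})_{1\le i,j\le n}$ with $\tilde r_{ij}=\cos\frac{\pi}{m_{s_is_j}}$ if $i<j$ and $\tilde r_{ij}=0$ if $i\ge j$, and let $Q_{\underline{w}}=(q_{ij})_{1\le i,j\le n}:=\tilde R_{\underline{w}}+\tilde R_{\underline{w}}^2+\cdots+\tilde R_{\underline{w}}^n$. Then $$\overline{\mathrm{BS}}(\underline{w}):=\mathbb{R}[x_1,\ldots,x_n]/(q_1,\ldots,q_n),\qquad q_m:=x_m^2-\Bigl(\sum_{l=1}^{m-1}q_{lm}x_l\Bigr)^2,$$ graded with $\deg x_i=1$; $\overline{\mathrm{BS}}^k(\underline{w})$ is the degree-$k$ part. The squarefree monomials $x_1^{\varepsilon_1}\cdots x_n^{\varepsilon_n}$, $\varepsilon_i\in\{0,1\}$, form an $\mathbb{R}$-basis of $\overline{\mathrm{BS}}(\underline{w})$; the ''coefficient of $x_1x_2\cdots x_n$'' is taken with respect to this basis. A symmetric bilinear form $b$ is $(-1)^k$-definite if $(-1)^kb$ is positive definite. $\ker(\ell_n^{\,n-2k+1})$ denotes the kernel of multiplication by $\ell_n^{\,n-2k+1}$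 on $\overline{\mathrm{BS}}^k(\underline{w})$. *)

(* Defs.v *)
From HB Require Import structures.
From mathcomp Require Import all_boot all_order all_algebra ring_quotient.
From mathcomp Require Import boolp classical_sets functions reals trigo.
(* The notations of [mpoly] clash with those of MathComp-Analysis. *)
From mathcomp Require Import -(notations) mpoly.

Set Implicit Arguments.
Unset Strict Implicit.
Unset Printing Implicit Defensive.

Import Order.TTheory GRing.Theory Num.Theory.

Local Open Scope classical_set_scope.
Local Open Scope ring_scope.
Local Open Scope quotient_scope.

(* [m s t = None] encodes m_st = oo.  The last two fields say that W is
   presented by the generators S and the relations (st)^m_st = 1, by the
   universal property of the presentation. *)
Record coxeterSystem := CoxeterSystem {
  cox_group : groupType ;
  cox_gen :> finType ;
  cox_incl : cox_gen -> cox_group ;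
  cox_m : cox_gen -> cox_gen -> option nat ;
  cox_incl_inj : injective cox_incl ;
  cox_m_diag : forall s, cox_m s s = Some 1%N ;
  cox_m_sym : forall s t, cox_m s t = cox_m t s ;
  cox_m_offdiag : forall s t k, s != t -> cox_m s t = Some k -> (2 <= k)%N ;
  cox_rel : forall s t k, cox_m s t = Some k ->
    ((cox_incl s * cox_incl t) ^+ k = 1)%g ;
  cox_univ : forall (G : groupType) (f : cox_gen -> G),
    (forall s t k, cox_m s t = Some k -> ((f s * f t) ^+ k = 1)%g) ->
    exists! phi : cox_group -> G,
      {morph phi : x y / (x * y)%g} /\ (forall s, phi (cox_incl s) = f s)
}.

Section BottSamelson.
Variables (R : realType) (C : coxeterSystem) (n : nat) (w : n.-tuple C).

Definition cox_angle (s t : C) : R :=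
  if cox_m s t is Some k then pi / k%:R else 0.

Definition BS_R : 'M[R]_n :=
  \matrix_(i < n, j < n)
    if (i < j)%N then cos (cox_angle (tnth w i) (tnth w j)) else 0.

Definition BS_Q : 'M[R]_n := \sum_(1 <= k < n.+1) BS_R ^+ k.

Definition BS_var (i : 'I_n) : mpoly n R := mpolyX R (mnm1 i).

Definition BS_q (m : 'I_n) : mpoly n R :=
  BS_var m ^+ 2 - (\sum_(l < n | (l < m)%N) BS_Q l m *: BS_var l) ^+ 2.

Definition BS_ideal : {pred mpoly n R} :=
  fun p => `[< exists a : 'I_n -> mpoly n R, p = \sum_i a i * BS_q i >].

Lemma BS_ideal_closed : idealr_closed BS_ideal.
Proof.
split.
- by apply/asboolP; exists (fun=> 0); rewrite big1 // => i _; rewrite mul0r.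
- apply/negP => /asboolP[a a1].
  have := congr1 (meval (fun=> 0)) a1.
  rewrite rmorph1 rmorph_sum big1 => [/eqP|i _]; first by rewrite oner_eq0.
  rewrite rmorphM /BS_q rmorphB !rmorphXn /= rmorph_sum big1 => [|l _].
    by rewrite mevalXU !expr0n subr0 mulr0.
  by rewrite /= mevalZ mevalXU mulr0.
- move=> a u v /asboolP[b ->] /asboolP[d ->]; apply/asboolP.
  exists (fun i => a * b i + d i).
  rewrite mulr_sumr -big_split; apply: eq_bigr => i _ /=.
  by rewrite mulrDl mulrA.
Qed.

HB.instance Definition _ :=
  isIdealr.Build (mpoly n R) BS_ideal BS_ideal_closed.

Definition BS := {ideal_quot BS_ideal}.
HB.instance Definition _ := GRing.ComNzRing.on BS.

Definition BS_pi (p : mpoly n R) : BS := \pi_{ideal_quot BS_ideal} p.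

Lemma BS_pi_is_zmod_morphism : zmod_morphism BS_pi.
Proof. by move=> p q; rewrite /BS_pi raddfB. Qed.
HB.instance Definition _ :=
  GRing.isZmodMorphism.Build (mpoly n R) BS BS_pi BS_pi_is_zmod_morphism.

Lemma BS_pi_is_monoid_morphism : monoid_morphism BS_pi.
Proof. by split=> [|p q]; rewrite /BS_pi ?rmorph1 ?rmorphM. Qed.
HB.instance Definition _ :=
  GRing.isMonoidMorphism.Build (mpoly n R) BS BS_pi BS_pi_is_monoid_morphism.

Definition BS_scale (a : R) (eta : BS) : BS := BS_pi (mpolyC n a) * eta.

Lemma BS_scaleA a b eta : BS_scale a (BS_scale b eta) = BS_scale (a * b) eta.
Proof. by rewrite /BS_scale mulrA -rmorphM -mpolyCM. Qed.
Lemma BS_scale1 : left_id 1 BS_scale.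
Proof. by move=> eta; rewrite /BS_scale mpolyC1 rmorph1 mul1r. Qed.
Lemma BS_scaleDr : right_distributive BS_scale +%R.
Proof. by move=> a u v; rewrite /BS_scale mulrDr. Qed.
Lemma BS_scaleDl eta : {morph BS_scale^~ eta : a b / a + b}.
Proof. by move=> a b; rewrite /BS_scale mpolyCD rmorphD mulrDl. Qed.
HB.instance Definition _ := GRing.Zmodule_isLmodule.Build R BS
  BS_scaleA BS_scale1 BS_scaleDr BS_scaleDl.

Lemma BS_scaleAl (a : R) (u v : BS) : a *: (u * v) = a *: u * v.
Proof. exact: mulrA. Qed.
HB.instance Definition _ := GRing.Lmodule_isLalgebra.Build R BS BS_scaleAl.

Lemma BS_scaleAr (a : R) (u v : BS) : a *: (u * v) = u * (a *: v).
Proof. exact: mulrCA. Qed.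
HB.instance Definition _ := GRing.Lalgebra_isAlgebra.Build R BS BS_scaleAr.

Definition BS_x (i : 'I_n) : BS := BS_pi (BS_var i).

Definition BS_deg (k : nat) : set BS :=
  [set BS_pi p | p in [set p : mpoly n R | p \is ishomog1 k mdeg]].

Definition BS_sqfree (A : {set 'I_n}) : BS := \prod_(i in A) BS_x i.

(* Coordinates in the basis of squarefree monomials; [xget] picks the unique
   family of coefficients representing [eta]. *)
Definition BS_coord (eta : BS) : {ffun {set 'I_n} -> R} :=
  xget 0 [set a : {ffun {set 'I_n} -> R} | eta = \sum_A a A *: BS_sqfree A].

Definition BS_degmap (eta : BS) : R := BS_coord eta [set: 'I_n]%SET.

Definition BS_prim (ell : BS) (k : nat) : set BS :=
  [set eta | BS_deg k eta /\ ell ^+ (n - k.*2).+1 * eta = 0].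

End BottSamelson.

Arguments BS_deg R {C n} w k _.

Definition nondegenerate_on (R : realType) (U V : lmodType R)
    (A : set U) (B : set V) (b : U -> V -> R) : Prop :=
  (forall u, A u -> (forall v, B v -> b u v = 0) -> u = 0) /\
  (forall v, B v -> (forall u, A u -> b u v = 0) -> v = 0).

Definition posdef_on (R : realType) (U : lmodType R)
    (A : set U) (b : U -> U -> R) : Prop :=
  forall u, A u -> u != 0 -> 0 < b u u.

(* Main.v *)
Require Import Defs.
From HB Require Import structures.
From mathcomp Require Import all_boot all_order all_algebra ring_quotient qpoly.
From mathcomp Require Import -(notations) mpoly.
From mathcomp Require Import ring zify.
From mathcomp Require Import boolp classical_sets functions reals.
From mathcomp Require Import topology normedtype.

Set Implicit Arguments.
Unset Strict Implicit.
Unset Printing Implicit Defensive.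

Import Order.TTheory GRing.Theory Num.Theory.
Import numFieldNormedType.Exports VectorInternalTheory.

Local Open Scope ring_scope.

(* Let A_m be the subalgebra generated by x_1, ..., x_m.  Then A_(m+1) is
   A_m[x]/(x^2 - L^2) with L linear in A_m, so Poincare duality passes from A_m
   to A_(m+1), and the rest is an induction on m with the class ell + e x,
   where ell has the Hodge-Riemann property on A_m and e > 0 is small.  In terms
   of x' = e x the algebra A_(m+1) is A_m[x']/(x'^2 - e^2 L^2), which for e = 0
   becomes A_m[x']/(x'^2) (a product with P^1), where the Hodge-Riemann property
   of ell + x' is an explicit computation.  By compactness of the unit sphere
   it persists for small e.  Hard Lefschetz then follows, because an element of
   its kernel would be primitive and isotropic, and the dimensions agree. *)

(** * Uniform positivity of continuous families of quadratic forms *)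

HB.structure Definition ComVAlgebra (R : nzRingType) :=
  {A of GRing.ComAlgebra R A & Vector R A}.

Section WeakContinuity.
Local Open Scope classical_set_scope.
Local Open Scope ring_scope.
Variable R : realType.

(* A finite-dimensional algebra carries no canonical topology in MathComp, so
   continuity is tested on linear forms. *)
Definition weakly_continuous (X : topologicalType) (V : lmodType R)
    (f : X -> V) : Prop :=
  forall psi : {scalar V}, continuous (fun z => psi (f z)).

Lemma continuous_add (X : topologicalType) (f g : X -> R) :
  continuous f -> continuous g -> continuous (fun z => f z + g z).
Proof.
by move=> cf cg z; apply: (@continuousD _ _ _ f g); [exact: cf|exact: cg].
Qed.

Lemma continuous_mul (X : topologicalType) (f g : X -> R) :
  continuous f -> continuous g -> continuous (fun z => f z * g z).
Proof.
by move=> cf cg z; apply: (@continuousM _ _ f g); [exact: cf|exact: cg].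
Qed.

Lemma continuous_sum (X : topologicalType) (I : Type) (r : seq I)
    (f : I -> X -> R) : (forall i, continuous (f i)) ->
  continuous (fun z => \sum_(i <- r) f i z).
Proof.
move=> cf; elim: r => [|i r IH].
  by under eq_fun do rewrite big_nil; exact: cst_continuous.
under eq_fun do rewrite big_cons.
by apply: continuous_add.
Qed.

Lemma scalar_continuous d (psi : {scalar 'rV[R]_d}) :
  continuous (psi : 'rV[R]_d -> R).
Proof.
have -> : (psi : 'rV[R]_d -> R) = fun v => \sum_i v 0 i * psi (delta_mx 0 i).
  apply: funext => v; rewrite [in LHS](row_sum_delta v) raddf_sum /=.
  by apply: eq_bigr => i _; rewrite linearZ.
apply: continuous_sum => i.
by apply: continuous_mul; [exact: coord_continuous|exact: cst_continuous].
Qed.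

Section Operations.
Variables (X : topologicalType) (T : ComVAlgebra.type R).
Implicit Types f g : X -> T.

Lemma weakly_continuous_cst (a : T) : weakly_continuous (fun _ : X => a).
Proof. by move=> psi; exact: cst_continuous. Qed.

Lemma weakly_continuousD f g : weakly_continuous f -> weakly_continuous g ->
  weakly_continuous (fun z => f z + g z).
Proof.
move=> cf cg psi; under eq_fun do rewrite raddfD.
by apply: continuous_add; [exact: cf|exact: cg].
Qed.

(** Expanding both factors in a basis turns [psi] of the product into a finite sum of products of
    coordinates, and coordinates are linear forms. *)
Lemma weakly_continuousM f g : weakly_continuous f -> weakly_continuous g ->
  weakly_continuous (fun z => f z * g z).
Proof.
move=> cf cg psi.
pose e := vbasis {: T}.
have -> : (fun z => psi (f z * g z)) = (fun z => \sum_i \sum_j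
    coord e i (f z) * coord e j (g z) * psi (e`_i * e`_j)).
  apply: funext => z.
  rewrite [f z in LHS](coord_vbasis (memvf _)) mulr_suml raddf_sum /=.
  apply: eq_bigr => i _.
  rewrite [g z in LHS](coord_vbasis (memvf _)) mulr_sumr raddf_sum /=.
  apply: eq_bigr => j _.
  by rewrite -scalerAl -scalerAr scalerA linearZ.
apply: continuous_sum => i; apply: continuous_sum => j.
apply: continuous_mul; last exact: cst_continuous.
by apply: continuous_mul; [exact: (cf (coord e i))|exact: (cg (coord e j))].
Qed.

Lemma weakly_continuousZ (a : X -> R) f : continuous a -> weakly_continuous f ->
  weakly_continuous (fun z => a z *: f z).
Proof.
move=> ca cf psi; under eq_fun do rewrite linearZ.
by apply: continuous_mul; [exact: ca|exact: cf].
Qed.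

End Operations.

Lemma weakly_continuous_r2v (W V : vectType R) (g : {linear W -> V}) :
  weakly_continuous (fun z : 'rV[R]_(dim W) * R => g (r2v z.1)).
Proof.
move=> psi z; apply: (@cvg_comp _ _ _ fst (fun v => psi (g (r2v v)))).
  exact: cvg_fst.
exact: (@scalar_continuous _ (psi \o g \o r2v)).
Qed.

(** The subspace cut out by [f1 e] and [f2 e] may jump with [e], so it enters through its equations.
    At a point of the unit sphere and [e = 0], either an equation fails or [q] is positive. Each
    alternative is open in the point and [e], so compactness gives one neighbourhood of 0, and
    homogeneity extends the result beyond the sphere. *)
Lemma posdef_near0 (W V : vectType R) (f1 f2 : R -> W -> V) (q : R -> W -> R) :
  weakly_continuous (fun z : 'rV[R]_(dim W) * R => f1 z.2 (r2v z.1)) ->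
  weakly_continuous (fun z : 'rV[R]_(dim W) * R => f2 z.2 (r2v z.1)) ->
  continuous (fun z : 'rV[R]_(dim W) * R => q z.2 (r2v z.1)) ->
  (forall e a w, f1 e (a *: w) = a *: f1 e w) ->
  (forall e a w, f2 e (a *: w) = a *: f2 e w) ->
  (forall e a w, q e (a *: w) = a ^+ 2 * q e w) ->
  (forall w, w != 0 -> f1 0 w = 0 -> f2 0 w = 0 -> 0 < q 0 w) ->
  \forall e \near (0 : R), forall w, w != 0 -> f1 e w = 0 -> f2 e w = 0 -> 0 <
    q e w.
Proof.
move=> c1 c2 cq h1 h2 hq pos.
pose K := [set v : 'rV[R]_(dim W) | `|v| = 1].
have Kc : compact K.
  apply: bounded_closed_compact.
    by exists 1; split; [exact: num_real|move=> M M1 v /= ->; exact: ltW].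
  rewrite (_ : K = (fun v => `|v|) @^-1` [set 1]); last by [].
  apply: preimage_closed; first by move=> v _; exact: norm_continuous.
  exact: closed_eq.
(* A nonzero vector has a nonzero coordinate, which stays nonzero nearby by weak continuity. *)
have near_neq (f : R -> W -> V) v :
    weakly_continuous (fun z : 'rV[R]_(dim W) * R => f z.2 (r2v z.1)) ->
    f 0 (r2v v) != 0 -> \forall v' \near v & e \near (0 : R), f e (r2v v') != 0.
  move=> cf fn0.
  have [i ci] : exists i, coord (vbasis {: V}) i (f 0 (r2v v)) != 0.
    apply/existsP; apply: contraNT fn0; rewrite negb_exists => /forallP H.
    rewrite [f _ _](coord_vbasis (memvf _)) big1 // => i _.
    by move: (H i); rewrite negbK => /eqP->; rewrite scale0r.
  have := @cvgr_neq0 R R^o _ _ (nbhs_filter _) _ _ (cf (coord (vbasis {: V}) i)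
    (v, 0)) ci.
  by apply: filterS => -[v' e] /=; apply: contraNN => /eqP->; rewrite raddf0.
pose P e (v : 'rV[R]_(dim W)) :=
  f1 e (r2v v) = 0 -> f2 e (r2v v) = 0 -> 0 < q e (r2v v).
have H : \forall e \near (0 : R), K `<=` P e.
  have /compact_near_coveringP KP := Kc.
  apply: (KP R (nbhs (0 : R)) P (nbhs_filter _)) => v Kv; rewrite /P.
  have [f10|/near_neq-/(_ c1)] := eqVneq (f1 0 (r2v v)) 0; last first.
    by apply: filterS => -[v' e] /= /eqP.
  have [f20|/near_neq-/(_ c2)] := eqVneq (f2 0 (r2v v)) 0; last first.
    by apply: filterS => -[v' e] /= /eqP.
  have vn0 : r2v v != 0.
    apply/eqP => v0; have := Kv; rewrite /K /= -(r2vK v) v0 linear0 normr0.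
    by move/eqP; rewrite eq_sym oner_eq0.
  have := @cvgr_gt R _ _ (nbhs_filter _) _ _ (cq (v, 0)) _ (pos _ vn0 f10 f20).
  by apply: filterS => -[v' e] /=.
apply: filterS H => e He w wn0 w1 w2.
have vn0 : `|v2r w| != 0.
  by rewrite normr_eq0; apply: contra_neq wn0 => v0; rewrite -(v2rK w) v0
    linear0.
have := He (`|v2r w|^-1 *: v2r w).
rewrite /P linearZ /= v2rK h1 h2 hq w1 w2 !scaler0.
rewrite pmulr_rgt0 ?exprn_gt0 ?invr_gt0 ?lt0r ?vn0 ?normr_ge0 //.
by apply => //; rewrite /K /= normrZ normfV normr_id mulVf.
Qed.

End WeakContinuity.

(** * Iterated quadratic extensions *)

Section Tower.
Local Open Scope classical_set_scope.
Local Open Scope ring_scope.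
Variables (R : realType) (T : ComVAlgebra.type R) (x : nat -> T).

(** A shifted grading with 0 in degree -1; the truncated predecessor would repeat degree 0. *)
Definition lower (H : nat -> {vspace T}) (k : nat) : {vspace T} :=
  if k is k'.+1 then H k' else 0%VS.

(** Under the relations [xL] below, this is the degree [k] part of A_m. Closure under products is
    [graded_mul], and directness of the sum follows from [graded_free]. *)
Fixpoint graded (m : nat) : nat -> {vspace T} :=
  if m is m'.+1 then
    fun k => (graded m' k + linfun (x m' \o* idfun) @: lower (graded m') k)%VS
  else fun k => if k is 0 then <[1]>%VS else 0%VS.

Lemma mem_gradedS m k u :
  (u \in graded m.+1 k) <->
  exists a b, [/\ a \in graded m k, b \in lower (graded m) k & u = a + b * x m].
Proof.
split=> [/memv_addP[a aG [_ /memv_imgP[b bG ->] ->]]|[a [b [aG bG ->]]]].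
  by exists a, b; rewrite lfunE.
apply/memv_addP; exists a => //; exists (b * x m) => //.
by apply/memv_imgP; exists b => //; rewrite lfunE.
Qed.

Lemma graded1 m : 1 \in graded m 0.
Proof.
elim: m => [|m IH]; first exact: memv_line.
by apply/mem_gradedS; exists 1, 0; rewrite IH mem0v mul0r addr0.
Qed.

Lemma gradedW m k u : u \in graded m k -> u \in graded m.+1 k.
Proof.
by move=> uG; apply/mem_gradedS; exists u, 0; rewrite uG mem0v mul0r addr0.
Qed.

Lemma graded_x m i : (i < m)%N -> x i \in graded m 1.
Proof.
elim: m => // m IH; rewrite ltnS leq_eqVlt => /orP[/eqP->|/IH /gradedW //].
by apply/mem_gradedS; exists 0, 1; rewrite mem0v (graded1 m) mul1r add0r.
Qed.

Lemma graded_gt m k : (m < k)%N -> graded m k = 0%VS.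
Proof.
elim: m k => [|m IH] [|k]//= mk.
by rewrite !IH ?limg0 ?addv0 // ltnW.
Qed.

Variables (n : nat) (L : nat -> T) (phi : {scalar T}).
Hypothesis LG : forall m, (m < n)%N -> L m \in graded m 1.
Hypothesis xL : forall m, (m < n)%N -> x m ^+ 2 = L m ^+ 2.
Hypothesis phi1 : phi (\prod_(0 <= i < n) x i) = 1.

(** A product of [a + b * x m] and [c + d * x m] involves [x m ^+ 2], which [xL] trades for
    [L m ^+ 2], of degree 2 in A_m. *)
Lemma graded_mul m i j u v : (m <= n)%N ->
  u \in graded m i -> v \in graded m j -> u * v \in graded m (i + j).
Proof.
elim: m i j u v => [|m IH] i j u v mn.
  case: i j => [|i] [|j]; rewrite /= ?memv0.
  - by case/vlineP=> r -> /vlineP[s ->]; rewrite -scalerAl mul1r scalerA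
      rpredZ // memv_line.
  - by move=> _ /eqP->; rewrite mulr0.
  - by move=> /eqP->; rewrite mul0r.
  - by move=> /eqP->; rewrite mul0r.
move=> /mem_gradedS[a [b [aG bG ->]]] /mem_gradedS[c [d [cG dG ->]]].
have {}IH := IH _ _ _ _ (ltnW mn).
apply/mem_gradedS; exists (a * c + L m ^+ 2 * (b * d)), (a * d + b * c); split.
- apply: rpredD; first exact: IH.
  case: i bG {aG} => [|i] /=.
    by rewrite memv0 => /eqP->; rewrite mul0r mulr0 mem0v.
  case: j dG {cG} => [|j] /= dG bG.
    by move: dG; rewrite memv0 => /eqP->; rewrite !mulr0 mem0v.
  rewrite addSn addnS; apply: (IH 2%N (i + j)%N); last exact: IH.
  by rewrite expr2; apply: (IH 1%N 1%N); apply: LG.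
- rewrite rpredD //.
  + case: j dG {cG} => [|j] /=; first by rewrite memv0 => /eqP->; rewrite mulr0
    mem0v.
    by move=> dG; rewrite addnS /= IH.
  + case: i bG {aG} => [|i] /=; first by rewrite memv0 => /eqP->; rewrite mul0r
    mem0v.
    by move=> bG; rewrite IH.
- by rewrite -xL //; ring.
Qed.

Lemma graded_exp m u k : (m <= n)%N -> u \in graded m 1 -> u ^+ k \in graded m
  k.
Proof.
move=> mn uG; elim: k => [|k IH]; first by rewrite expr0 graded1.
by rewrite exprS -add1n graded_mul.
Qed.

(* [phi (_ * cotop m)] is the degree map of the subalgebra generated by
   [x 0, ..., x (m - 1)]. *)
Definition cotop m : T := \prod_(m <= i < n) x i.

Lemma cotopS m : (m < n)%N -> cotop m = x m * cotop m.+1.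
Proof. by move=> mn; rewrite /cotop big_ltn. Qed.

Lemma graded_gt0 m k u : (m < k)%N -> u \in graded m k -> u = 0.
Proof. by move=> mk; rewrite graded_gt // memv0 => /eqP. Qed.

(** For [k > m] the truncated [m - k] is harmless, since [graded m k] is then 0. *)
Definition pairing_nondegenerate m := forall k u, u \in graded m k ->
  (forall v, v \in graded m (m - k) -> phi (u * v * cotop m) = 0) -> u = 0.

(** Testing against [v * x m] isolates [a], and testing against [v] in A_m isolates [b]. The
    remaining term has each time a factor of degree [m + 1] in A_m, hence vanishes. *)
Lemma pairing_step m k a b : (m < n)%N -> pairing_nondegenerate m ->
  a \in graded m k -> b \in lower (graded m) k ->
  (forall v, v \in graded m.+1 (m.+1 - k) ->
     phi ((a + b * x m) * v * cotop m.+1) = 0) ->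
  a = 0 /\ b = 0.
Proof.
move=> mn PD aG bG H; split.
  have [km|mk] := leqP k m; last exact: graded_gt0 aG.
  apply: PD aG _ => v vG.
  have := H (v * x m).
  have -> : (a + b * x m) * (v * x m) * cotop m.+1 =
            a * v * cotop m + L m ^+ 2 * (b * v) * cotop m.+1.
    by rewrite (cotopS mn) -(xL mn); ring.
  rewrite raddfD /= (_ : L m ^+ 2 * (b * v) = 0) ?mul0r ?raddf0 ?addr0.
    apply; apply/mem_gradedS; exists 0, v; rewrite mem0v add0r; split=> //.
    by rewrite subSn.
  case: k bG km vG {H} => [|k] /= bG km vG.
    by move: bG; rewrite memv0 => /eqP->; rewrite mul0r mulr0.
  apply: (@graded_gt0 m (2 + (k + (m - k.+1)))); first lia.
  apply: graded_mul; [exact: ltnW| |exact: graded_mul (ltnW mn) bG vG].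
  by apply: graded_exp; [exact: ltnW|exact: LG].
case: k bG aG H => [|k] /= bG aG H; first by move: bG; rewrite memv0 => /eqP.
apply: PD bG _ => v vG.
have := H v.
have -> : (a + b * x m) * v * cotop m.+1 = b * v * cotop m + a * v * cotop m.+1.
  by rewrite (cotopS mn); ring.
rewrite raddfD /= (_ : a * v = 0) ?mul0r ?raddf0 ?addr0.
  by apply; apply/gradedW; rewrite subSS.
have [km|mk] := leqP k m; last by rewrite (graded_gt0 _ aG) ?mul0r // ltnW.
apply: (@graded_gt0 m (k.+1 + (m - k))); first lia.
by apply: graded_mul => //; exact: ltnW.
Qed.

Lemma graded_pairing_nondegenerate m : (m <= n)%N -> pairing_nondegenerate m.
Proof.
elim: m => [|m IH] mn k u.
  case: k => [|k] /=; last by rewrite memv0 => /eqP.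
  case/vlineP=> r -> /(_ 1 (memv_line _)).
  by rewrite mulr1 -scalerAl mul1r linearZ /= /cotop phi1 mulr1 => ->; rewrite
    scale0r.
case/mem_gradedS=> a [b [aG bG ->]] H.
have [->->] := pairing_step mn (IH (ltnW mn)) aG bG H.
by rewrite mul0r addr0.
Qed.

(** Zero pairs to zero with everything, so duality makes 1 and [x m] independent over A_m. *)
Lemma graded_free m k a b : (m < n)%N -> a \in graded m k -> b \in lower
  (graded m) k ->
  a + b * x m = 0 -> a = 0 /\ b = 0.
Proof.
move=> mn aG bG ab0.
apply: pairing_step aG bG _ => //; first
  exact/graded_pairing_nondegenerate/ltnW.
by move=> v _; rewrite ab0 !mul0r raddf0.
Qed.

(** By [graded_free] the sum defining [graded] is direct and multiplication by [x m] is injective on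
    A_m, so the dimensions obey Pascal's rule. Their symmetry upgrades injectivity to bijectivity in
    hard Lefschetz. *)
Lemma dim_graded m k : (m <= n)%N -> \dim (graded m k) = 'C(m, k).
Proof.
elim: m k => [|m IH] k mn.
  case: k => [|k] /=; last by rewrite dimv0.
  by rewrite dim_vline oner_eq0.
have mn' := ltnW mn.
rewrite /= dimv_disjoint_sum; last first.
  apply/eqP; rewrite -subv0; apply/subvP => u /memv_capP[aG /memv_imgP[b bG]].
  rewrite lfunE /= => ub; have [||-> _] := @graded_free m k u (- b) mn aG.
  - by rewrite rpredN.
  - by rewrite mulNr ub subrr.
  - exact: mem0v.
rewrite limg_dim_eq; last first.
  apply/eqP; rewrite -subv0; apply/subvP => b /memv_capP[bG].
  rewrite memv_ker lfunE /= => /eqP bx.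
  have [||_ ->] := @graded_free m k 0 b mn _ bG.
  - exact: mem0v.
  - by rewrite add0r.
  - exact: mem0v.
by case: k => [|k] /=; rewrite ?dimv0 !IH // ?bin0 // binS.
Qed.

Definition hodge_riemann m (ell : T) := forall k u, (k.*2 <= m)%N ->
  u \in graded m k -> ell ^+ (m - k.*2).+1 * u = 0 -> u != 0 ->
  0 < (-1) ^+ k * phi (ell ^+ (m - k.*2) * u * u * cotop m).

(** * Hard Lefschetz, and the Hodge-Riemann relations for a product with P^1 *)

Section Lefschetz.
Variables (m : nat) (ell : T).
Hypotheses (mn : (m <= n)%N) (ellG : ell \in graded m 1) (HR : hodge_riemann m
  ell).

Lemma lefschetz_inj k u : (k.*2 <= m)%N -> u \in graded m k ->
  ell ^+ (m - k.*2) * u = 0 -> u = 0.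
Proof.
move=> km uG u0; apply/eqP/negPn/negP => un0.
have := HR km uG; rewrite u0 !mul0r raddf0 mulr0 ltxx exprS -mulrA u0 mulr0.
by move=> /(_ erefl un0).
Qed.

Lemma lefschetz_surj k v : (k.*2 <= m)%N -> v \in graded m (m - k) ->
  exists2 u, u \in graded m k & v = ell ^+ (m - k.*2) * u.
Proof.
move=> km vG; pose f := linfun (ell ^+ (m - k.*2) \*o @idfun T).
have fG : (f @: graded m k)%VS = graded m (m - k).
  apply/eqP; rewrite eqEdim; apply/andP; split.
    apply/subvP => _ /memv_imgP[u uG ->]; rewrite lfunE /=.
    by rewrite (_ : m - k = (m - k.*2) + k)%N; [rewrite graded_mul
      ?graded_exp|lia].
  rewrite limg_dim_eq ?dim_graded ?bin_sub //; first by lia.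
  apply/eqP; rewrite -subv0; apply/subvP => u /memv_capP[uG].
  by rewrite memv_ker lfunE memv0 /= => /eqP /(lefschetz_inj km uG)->.
move: vG; rewrite -fG => /memv_imgP[u uG ->].
by exists u; rewrite ?lfunE.
Qed.

(* The form of A[x]/(x^2) with respect to [ell + x]: write
   [a = p + ell * c] with [p] primitive; then [c] is primitive too,
   [b = - (N + 1) * c], and the form splits as
   [N * <p, p>_k - (N + 2) * <c, c>_(k-1)]. *)
Lemma hodge_riemann_product k N a b : (N + k.*2 = m.+1)%N ->
  a \in graded m k -> b \in lower (graded m) k ->
  ell ^+ N.+1 * a = 0 -> ell ^+ N.+1 * b + N.+1%:R * ell ^+ N * a = 0 ->
  (a != 0) || (b != 0) ->
  0 < (-1) ^+ k *
      phi ((N%:R * ell ^+ N.-1 * (a * a) + 2 * (ell ^+ N * (a * b))) * cotop m).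
Proof.
move=> km aG bG a0 b0 ab.
(* These are the Hodge-Riemann relations of A_m, with [N.-1 = m - k.*2]. If [N = 0], the assumption
   on [p] already says [p = 0]. *)
have posP p : p \in graded m k -> ell ^+ N * p = 0 ->
    0 <= (-1) ^+ k * phi (N%:R * ell ^+ N.-1 * (p * p) * cotop m) ?= iff (p ==
      0).
  move=> pG p0; have [->|pn0] := eqVneq p 0.
    by rewrite !mulr0 mul0r raddf0 mulr0; split; rewrite ?eqxx.
  have [N0|N0] := posnP N; first by rewrite N0 expr0 mul1r in p0; rewrite p0
    eqxx in pn0.
  have km' : (k.*2 <= m)%N by lia.
  have N1 : N.-1 = (m - k.*2)%N by lia.
  have := HR km' pG; rewrite -N1 prednK // => /(_ p0 pn0) H.
  have -> : N%:R * ell ^+ N.-1 * (p * p) * cotop m = N%:R *: (ell ^+ N.-1 * p *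
    p * cotop m).
    by rewrite scaler_nat -mulr_natl; ring.
  by rewrite linearZ /= mulrCA; apply/leifP; rewrite mulr_gt0 ?ltr0n.
(* In degree 0, [b] vanishes and [a] is primitive, because [ell ^+ N * a] has degree [m + 1]. *)
have [k0|k0] := posnP k.
  rewrite k0 /= memv0 in bG; move: ab; rewrite (eqP bG) eqxx orbF => an0.
  have N1 : N = m.+1 by lia.
  have aN : ell ^+ N * a = 0.
    apply: (@graded_gt0 m (N + k)); first by rewrite N1; lia.
    by rewrite graded_mul ?graded_exp.
  by rewrite !mulr0 addr0 (lt_leif (posP _ aG aN)).
case: k k0 km aG bG posP => // k _ km aG bG posP.
rewrite /= in bG.
have km' : (k.*2 <= m)%N by lia.
have NE : (m - k.*2)%N = N.+1 by lia.
(* Now [a] has degree [k.+1], so [ell ^+ N * a] has degree [m - k], onto which [ell ^+ N.+1] maps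
   degree [k]. *)
have [c cG cE] : exists2 c, c \in graded m k & ell ^+ N * a = ell ^+ N.+1 * c.
  rewrite -NE; apply: lefschetz_surj => //.
  by rewrite (_ : m - k = N + k.+1)%N; [rewrite graded_mul ?graded_exp|lia].
have bE : b = - (N.+1%:R * c).
  apply/eqP; rewrite -addr_eq0; apply/eqP; apply: (@lefschetz_inj k) => //.
    by rewrite rpredD // mulr_natl rpredMn.
  by rewrite NE -[RHS]b0 -[N.+1%:R * _ * a]mulrA cE; ring.
pose p := a - ell * c.
have pG : p \in graded m k.+1 by rewrite rpredB // -add1n graded_mul.
have p0 : ell ^+ N * p = 0 by rewrite /p mulrBr cE exprSr; ring.
have c0 : ell ^+ N.+2 * c = 0 by rewrite -[RHS]a0 !exprS -!mulrA cE exprS; ring.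
have posC : 0 <= (-1) ^+ k * phi (ell ^+ N.+1 * c * c * cotop m) ?= iff (c ==
  0).
  have [->|cn0] := eqVneq c 0; first by rewrite !mulr0 mul0r raddf0 mulr0;
    split; rewrite ?eqxx.
  have := HR km' cG; rewrite NE => /(_ c0 cn0) H.
  by apply/leifP.
(* The cross terms contain [ell ^+ N * p = 0], and the [c] terms add up with coefficient
   [N - 2 * (N + 1)]. *)
have -> : N%:R * ell ^+ N.-1 * (a * a) + 2 * (ell ^+ N * (a * b)) =
    N%:R * ell ^+ N.-1 * (p * p) - N.+2%:R * (ell ^+ N.+1 * c * c).
  have aE : a = p + ell * c by rewrite subrK.
  have -> : N%:R * ell ^+ N.-1 * (a * a) = N%:R * ell ^+ N.-1 * (p * p) +
     2 * N%:R * (ell ^+ N * p) * c + N%:R * ell ^+ N.+1 * c * c.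
    rewrite aE; case: (N) => [|N']; first by rewrite !(mul0r, mulr0) !addr0.
    by rewrite /= !exprS; ring.
  have -> : ell ^+ N * (a * b) = - (N.+1%:R * ell ^+ N.+1 * c * c).
    by rewrite mulrA cE bE; ring.
  by rewrite p0 -!natr1; ring.
rewrite mulrDl raddfD /= mulrDr.
have -> : - (N.+2%:R * (ell ^+ N.+1 * c * c)) * cotop m =
     (- N.+2%:R) *: (ell ^+ N.+1 * c * c * cotop m).
  by rewrite scaleNr scaler_nat -mulr_natl; ring.
(* The minus sign of the [c] term absorbs one factor of [(-1) ^+ k.+1], since [c] lives one degree
   lower. *)
rewrite linearZ /= exprS [X in _ + X](_ : _ = N.+2%:R *
   ((-1) ^+ k * phi (ell ^+ N.+1 * c * c * cotop m))); last by ring.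
(* Strictness comes from [c] if it is nonzero. Otherwise [b = 0] and [a = p], so it comes from
   [p]. *)
have [c00|cn0] := eqVneq c 0.
  have pn0 : p != 0.
    by apply: contraL ab => /eqP p00; rewrite bE -(subrK (ell * c) a) -/p p00
      c00;
      rewrite !mulr0 addr0 oppr0 eqxx.
  rewrite c00 !(mulr0, mul0r) raddf0 !mulr0 addr0.
  by rewrite -exprS (lt_leif (posP _ pG p0)).
rewrite ltr_wpDl //; first by rewrite -exprS (posP _ pG p0).
by rewrite mulr_gt0 ?ltr0n // (lt_leif posC).
Qed.

End Lefschetz.

(** * From A_m to A_(m+1) with a small new coefficient *)

Section Step.
Variables (m : nat) (ell : T).
Hypotheses (mn : (m < n)%N) (ellG : ell \in graded m 1) (HR : hodge_riemann m
  ell).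

(* Turns scalings into products, for the benefit of [ring]. *)
Lemma scaler_rmorph : exists f : {rmorphism R -> T}, forall r z, r *: z = f r *
  z.
Proof. by exists (in_alg T) => r z; rewrite /= mulr_algl. Qed.

(* [(ell + e * x m) ^ j = U + V * (e * x m)]. *)
Fixpoint pow_coefs (e : R) (j : nat) : T * T :=
  if j is j'.+1 then
    let: (U, V) := pow_coefs e j' in
    (ell * U + e ^+ 2 *: (L m ^+ 2 * V), ell * V + U)
  else (1, 0).

Lemma pow_coefsP e j : (ell + e *: x m) ^+ j =
  (pow_coefs e j).1 + (pow_coefs e j).2 * (e *: x m).
Proof.
have xe : (e *: x m) * (e *: x m) = e ^+ 2 *: L m ^+ 2.
  by rewrite -xL // -scalerAl -scalerAr scalerA.
elim: j => [|j IH]; first by rewrite expr0 mul0r addr0.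
rewrite exprS IH /=; case: (pow_coefs e j) => U V /=.
by rewrite scalerAl -xe; ring.
Qed.

Lemma pow_coefs_graded e j :
  ((pow_coefs e j).1 \in graded m j) && ((pow_coefs e j).2 \in lower (graded m)
    j).
Proof.
have mn' := ltnW mn.
elim: j => [|j IH]; first by rewrite graded1 mem0v.
move: IH => /=; case: (pow_coefs e j) => U V /= /andP[UG VG].
apply/andP; split; apply: rpredD => //.
- by rewrite -add1n graded_mul.
- apply: rpredZ; case: j VG {UG} => [|j] /=.
    by rewrite memv0 => /eqP->; rewrite mulr0 mem0v.
  by move=> VG; rewrite -[j.+2]/(2 + j)%N graded_mul // graded_exp // LG.
- case: j VG {UG} => [|j] /=.
    by rewrite memv0 => /eqP->; rewrite mulr0 mem0v.
  by move=> VG; rewrite -add1n graded_mul.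
Qed.

(** When [x'] squares to zero, only the first two binomial terms survive. At [j = 0] the factor
    [j%:R] kills the term with the truncated exponent. *)
Lemma pow_coefs0 j : pow_coefs 0 j = (ell ^+ j, j%:R * ell ^+ j.-1).
Proof.
elim: j => [|j /= ->]; first by rewrite mul0r.
rewrite expr0n scale0r addr0 -exprS; congr pair.
case: j => [|j]; first by rewrite !mul0r mulr0 add0r mul1r.
by rewrite /= -natr1 !exprS; ring.
Qed.

Lemma pow_coefs_continuous (X : topologicalType) (e : X -> R) j :
  continuous e ->
  weakly_continuous (fun z => (pow_coefs (e z) j).1) /\
  weakly_continuous (fun z => (pow_coefs (e z) j).2).
Proof.
move=> ce; elim: j => [|j [IH1 IH2]]; first by split; exact:
  weakly_continuous_cst.
have -> : (fun z => (pow_coefs (e z) j.+1).1) =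
    (fun z => ell * (pow_coefs (e z) j).1 +
              (e z ^+ 2) *: (L m ^+ 2 * (pow_coefs (e z) j).2)).
  by apply: funext => z /=; case: (pow_coefs (e z) j).
have -> : (fun z => (pow_coefs (e z) j.+1).2) =
    (fun z => ell * (pow_coefs (e z) j).2 + (pow_coefs (e z) j).1).
  by apply: funext => z /=; case: (pow_coefs (e z) j).
split; apply: weakly_continuousD => //.
- by apply: weakly_continuousM => //; exact: weakly_continuous_cst.
- apply: weakly_continuousZ; first exact: continuous_mul.
  by apply: weakly_continuousM => //; exact: weakly_continuous_cst.
- by apply: weakly_continuousM => //; exact: weakly_continuous_cst.
Qed.

Section Degree.
Variables (k N : nat).
Hypothesis kN : (N + k.*2 = m.+1)%N.

(** A pair [(a, b)] stands for [a + b * (e *: x m)], so the domain of the forms does not depend on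
    [e]. *)
Let W : vectType R := (subvs_of (graded m k) * subvs_of (lower (graded m)
  k))%type.
Let a (w : W) : T := vsval w.1.
Let b (w : W) : T := vsval w.2.
Let aZ c w : a (c *: w) = c *: a w.
Proof. by rewrite [LHS]linearZ. Qed.

Let bZ c w : b (c *: w) = c *: b w.
Proof. by rewrite [LHS]linearZ. Qed.

Let U e j := (pow_coefs e j).1.
Let V e j := (pow_coefs e j).2.

(* With [x' = e * x m], so that [x' ^ 2 = e ^ 2 * L m ^ 2], these are the two
   components of [(ell + x') ^ (N + 1) * (a + b * x')], and the coefficient of
   [x'] in [(ell + x') ^ N * (a + b * x') ^ 2]. *)
Let ker1 e w := U e N.+1 * a w + e ^+ 2 *: (L m ^+ 2 * (V e N.+1 * b w)).
Let ker2 e w := U e N.+1 * b w + V e N.+1 * a w.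
Let sqcoef e w := V e N * (a w * a w + e ^+ 2 *: (L m ^+ 2 * (b w * b w))) +
  2 * (U e N * (a w * b w)).
Let form e w := (-1) ^+ k * phi (sqcoef e w * cotop m).

(** An instance of [posdef_near0]: at [e = 0], [pow_coefs0] turns the equations and the form into
    those of [hodge_riemann_product]. *)
Lemma form_near0 : \forall e \near (0 : R), forall w, w != 0 ->
  ker1 e w = 0 -> ker2 e w = 0 -> 0 < form e w.
Proof.
have ca : weakly_continuous (fun z : 'rV[R]_(dim W) * R => a (r2v z.1)).
  exact: (@weakly_continuous_r2v _ W T (vsval \o fst)).
have cb : weakly_continuous (fun z : 'rV[R]_(dim W) * R => b (r2v z.1)).
  exact: (@weakly_continuous_r2v _ W T (vsval \o snd)).
have c2 : continuous (fun z : 'rV[R]_(dim W) * R => z.2).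
  by move=> z; exact: cvg_snd.
have cU j := (pow_coefs_continuous j c2).1.
have cV j := (pow_coefs_continuous j c2).2.
have cc c : weakly_continuous (fun z : 'rV[R]_(dim W) * R => c : T).
  exact: weakly_continuous_cst.
have ce : continuous (fun z : 'rV[R]_(dim W) * R => z.2 ^+ 2).
  exact: continuous_mul.
apply: posdef_near0.
- apply: weakly_continuousD; first exact: (weakly_continuousM (cU _) ca).
  apply: (weakly_continuousZ ce).
  exact: (weakly_continuousM (cc _) (weakly_continuousM (cV _) cb)).
- exact: (weakly_continuousD (weakly_continuousM (cU _) cb)
                            (weakly_continuousM (cV _) ca)).
- apply: continuous_mul; first exact: cst_continuous.
  have : weakly_continuous
      (fun z : 'rV[R]_(dim W) * R => sqcoef z.2 (r2v z.1) * cotop m).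
    apply: (weakly_continuousM _ (cc (cotop m))); apply: weakly_continuousD.
      apply: (weakly_continuousM (cV _) _).
      apply: weakly_continuousD; first exact: (weakly_continuousM ca ca).
      apply: (weakly_continuousZ ce).
      exact: (weakly_continuousM (cc _) (weakly_continuousM cb cb)).
    apply: (weakly_continuousM (cc _) _).
    exact: (weakly_continuousM (cU _) (weakly_continuousM ca cb)).
  by apply.
- move=> e c w; rewrite /ker1 aZ bZ scalerDr -!scalerAr.
  by rewrite !scalerA [e ^+ 2 * c]mulrC.
- move=> e c w; by rewrite /ker2 aZ bZ scalerDr -!scalerAr.
- move=> e c w; rewrite /form.
  have -> : sqcoef e (c *: w) = c ^+ 2 *: sqcoef e w.
    by rewrite /sqcoef aZ bZ; have [f fE] := scaler_rmorph; rewrite !fE; ring.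
  by rewrite -scalerAl linearZ /= mulrCA.
- move=> w wn0; rewrite /ker1 /ker2 /form /sqcoef /U /V !pow_coefs0 /=.
  rewrite expr0n !scale0r !addr0 => f1 f2.
  apply: (hodge_riemann_product (ltnW mn) ellG HR) => //.
  + exact: subvsP.
  + exact: subvsP.
  + apply: contraNT wn0; rewrite negb_or !negbK => /andP[/eqP a0 /eqP b0].
    by apply/eqP; case: w a0 b0 {f1 f2} => w1 w2 /= a0 b0; congr (_, _);
      apply/val_inj.
Qed.

(** For [e > 0] the substitution [x' = e *: x m] is invertible, which transfers [form_near0] to the
    elements of A_(m+1). *)
Lemma hodge_riemann_near0 : \forall e \near (0 : R)^'+, forall u,
  u \in graded m.+1 k -> (ell + e *: x m) ^+ N.+1 * u = 0 -> u != 0 ->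
  0 < (-1) ^+ k * phi ((ell + e *: x m) ^+ N * u * u * cotop m.+1).
Proof.
have mn' := ltnW mn.
rewrite near_withinE; apply: filterS form_near0 => e pos e0 u.
case/mem_gradedS=> a0 [b0 [aG bG ->]].
have [a1 aE] : exists a1 : subvs_of (graded m k), vsval a1 = a0 by exists
  (Subvs aG).
(* Dividing by [e] rewrites [b0 * x m] as a multiple of [x']. *)
have [b1 bE] : exists b1 : subvs_of (lower (graded m) k), vsval b1 = e^-1 *: b0.
  by exists (Subvs (rpredZ e^-1 bG)).
have {bE} bE : b0 * x m = vsval b1 * (e *: x m).
  by rewrite bE -scalerAl -scalerAr scalerA mulVf ?gt_eqF // scale1r.
rewrite bE -aE => {aG bG} H un0.
pose w : W := (a1, b1).
have aG : a w \in graded m k by exact: subvsP.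
have bG : b w \in lower (graded m) k by exact: subvsP.
have [UG VG] := andP (pow_coefs_graded e N.+1).
have [UG' VG'] := andP (pow_coefs_graded e N).
have tG : e ^+ 2 *: L m ^+ 2 \in graded m 2 by rewrite rpredZ // graded_exp //
  LG.
(* Freeness over A_m splits the primitivity equation into its two components; it is stated for [x m]
   rather than [x'], whence the factor [e]. *)
have [k1 k2] : ker1 e w = 0 /\ e *: ker2 e w = 0.
  apply: (@graded_free m (N.+1 + k) _ _ mn).
  - apply: rpredD; first exact: graded_mul.
    rewrite scalerAl; case: (k) bG => [|k'] /=.
      by rewrite memv0 => /eqP->; rewrite !mulr0 mem0v.
    move=> bG; rewrite addSn addnS; apply: (@graded_mul m 2 (N + k')) => //.
    exact: graded_mul.
  - rewrite rpredZ //= rpredD //; last by rewrite graded_mul.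
    case: (k) bG => [|k'] /=.
      by rewrite memv0 => /eqP->; rewrite !mulr0 mem0v.
    by move=> bG; rewrite addnS -addSn graded_mul.
  - rewrite -[RHS]H pow_coefsP -/(U _ _) -/(V _ _) -/(a w) -/(b w) /ker1 /ker2.
    by rewrite -(xL mn); have [f fE] := scaler_rmorph; rewrite !fE; ring.
have k2' : ker2 e w = 0.
  by move/eqP: k2; rewrite scaler_eq0 gt_eqF //= => /eqP.
have wn0 : w != 0.
  by apply: contra un0 => /eqP[-> ->]; rewrite !linear0 mul0r addr0.
have := pos w wn0 k1 k2'; rewrite /form.
(* This is the component without [x'] of the product to be evaluated. It has degree
   [N + k + k = m + 1] in A_m, hence is 0, which leaves [e] times the form. *)
pose c := U e N * (a w * a w + e ^+ 2 *: L m ^+ 2 * (b w * b w)) +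
          e ^+ 2 *: L m ^+ 2 * (V e N * (a w * b w)) *+ 2.
have c0 : c = 0.
  apply: (@graded_gt0 m (N + (k + k))); first by rewrite addnn kN.
  rewrite /c; apply: rpredD.
    apply: graded_mul => //; apply: rpredD; first exact: graded_mul.
    case: (k) bG => [|k'] /=.
      by rewrite memv0 => /eqP->; rewrite !mulr0 mem0v.
    move=> bG; rewrite addSn addnS; apply: (@graded_mul m 2 (k' + k')) => //.
    exact: graded_mul.
  apply: rpredMn.
  case: (N) VG' => [_|N']; first by rewrite /V /= mul0r mulr0 mem0v.
  move=> VG'; case: (k) aG bG => [|k'] /=.
    by rewrite memv0 => _ /eqP->; rewrite !mulr0 mem0v.
  move=> aG bG; rewrite (_ : N'.+1 + (k'.+1 + k'.+1) = 2 + (N' + (k'.+1 +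
    k')))%N; last by lia.
  apply: (@graded_mul m 2 (N' + (k'.+1 + k'))) => //.
  by apply: graded_mul => //; exact: graded_mul.
have -> : (ell + e *: x m) ^+ N * (vsval a1 + vsval b1 * (e *: x m)) *
   (vsval a1 + vsval b1 * (e *: x m)) * cotop m.+1 =
   c * cotop m.+1 + e *: (sqcoef e w * cotop m).
  rewrite (cotopS mn) pow_coefsP -/(U _ _) -/(V _ _) -/(a w) -/(b w) /c /sqcoef.
  by rewrite -(xL mn); have [f fE] := scaler_rmorph; rewrite !fE; ring.
by rewrite c0 mul0r add0r linearZ /= mulrCA; apply: mulr_gt0.
Qed.

End Degree.

Lemma hodge_riemann_step : exists2 e : R, 0 < e &
  hodge_riemann m.+1 (ell + e *: x m).
Proof.
(* Only finitely many degrees are concerned, so a single [e] works for all of them. *)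
have : \forall e \near (0 : R)^'+, forall k : 'I_m.+2, (k.*2 <= m.+1)%N ->
    forall u, u \in graded m.+1 k ->
    (ell + e *: x m) ^+ (m.+1 - k.*2).+1 * u = 0 -> u != 0 ->
    0 < (-1) ^+ k *
        phi ((ell + e *: x m) ^+ (m.+1 - k.*2) * u * u * cotop m.+1).
  apply: filter_forall => k; have [km|mk] := leqP k.*2 m.+1; last by apply:
    nearW.
  by apply: filterS (hodge_riemann_near0 (subnK km)) => e H _.
move=> H; near (0 : R)^'+ => e.
exists e => // k u km uG; have km' : (k < m.+2)%N by lia.
have He : forall k : 'I_m.+2, (k.*2 <= m.+1)%N ->
    forall u, u \in graded m.+1 k ->
    (ell + e *: x m) ^+ (m.+1 - k.*2).+1 * u = 0 -> u != 0 ->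
    0 < (-1) ^+ k *
        phi ((ell + e *: x m) ^+ (m.+1 - k.*2) * u * u * cotop m.+1).
  by near: e.
exact: (He (Ordinal km')).
Unshelve. all: by end_near.
Qed.

End Step.

Lemma hodge_riemann_exists m : (m <= n)%N -> exists c : nat -> R,
  (forall i, 0 < c i) /\ hodge_riemann m (\sum_(0 <= i < m) c i *: x i).
Proof.
elim: m => [|m IH] mn.
  (* The values 1 are placeholders: index [m] receives its coefficient in the step from [m] to
     [m.+1]. On A_0, which consists of scalars, the form is a square. *)
  exists (fun=> 1); split=> // k u; rewrite leqn0 double_eq0 => /eqP->.
  case/vlineP=> r -> _ rn0; rewrite !expr0 !(mul1r, =^~scalerAl).
  rewrite !linearZ /= /cotop phi1 mulr1 -expr2 exprn_even_gt0 //=.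
  by apply: contraNneq rn0 => ->; rewrite scale0r.
have [c [c0 HR]] := IH (ltnW mn).
have ellG : \sum_(0 <= i < m) c i *: x i \in graded m 1.
  rewrite big_nat; apply: rpred_sum => i /andP[_ im].
  by rewrite rpredZ ?graded_x.
have [e e0 HRe] := hodge_riemann_step mn ellG HR.
exists (fun i => if i == m then e else c i); split=> [i|]; first by case: ifP.
rewrite big_nat_recr //= eqxx (eq_big_nat _ _ (F2 := fun i => c i *: x i)) //.
by move=> i /andP[_ im]; rewrite ltn_eqF.
Qed.
End Tower.

(** * Linear independence of the squarefree monomials *)

Section QuadraticExtension.
Variables (K : comNzRingType) (t : K).
Let h : {poly K} := 'X^2 - t%:P.

Lemma quadratic_monic : h \is monic.
Proof. exact: monicXnsubC. Qed.

Lemma quadratic_size : size h = 3.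
Proof. exact: size_XnsubC. Qed.

(** The quotient [{poly %/ h}] reduces modulo [mk_monic h], which is [h] only for monic polynomials
    of positive degree. *)
Lemma quadratic_mk_monic : mk_monic h = h.
Proof. by rewrite /mk_monic quadratic_size quadratic_monic. Qed.

Lemma qpolyC_in_qpoly (u : K) : qpolyC h u = in_qpoly h u%:P.
Proof.
apply: val_inj; rewrite [RHS]in_qpoly_small //.
by rewrite quadratic_mk_monic quadratic_size (leq_ltn_trans (size_polyC_leq1
  _)).
Qed.

Lemma quadratic_sqr : in_qpoly h 'X ^+ 2 = qpolyC h t.
Proof.
rewrite qpolyC_in_qpoly -rmorphXn /=; apply/eqP; rewrite -subr_eq0 -rmorphB /=.
apply/eqP/val_inj; rewrite /= quadratic_mk_monic -/h.
by rewrite Pdiv.RingMonic.rmodpp // quadratic_monic.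
Qed.

(** A polynomial of degree less than 2 is its own remainder, so its coefficients can be read off in
    the quotient. *)
Lemma quadratic_free (u v : K) : qpolyC h u + qpolyC h v * in_qpoly h 'X = 0 ->
  u = 0 /\ v = 0.
Proof.
rewrite !qpolyC_in_qpoly -in_qpolyM -in_qpolyD => H.
have sz : (size (u%:P + v%:P * 'X)%R < size (mk_monic h))%N.
  rewrite quadratic_mk_monic quadratic_size addrC size_MXaddC; case: ifP => //
    _.
  by rewrite !ltnS size_polyC_leq1.
have uv0 : u%:P + v%:P * 'X = 0 by rewrite -(in_qpoly_small sz) H.
split.
- by have := congr1 (fun p : {poly K} => p`_0) uv0; rewrite coefD coefC coefMX
  coef0 addr0.
- by have := congr1 (fun p : {poly K} => p`_1) uv0; rewrite coefD coefMX !coefC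
  ?coef0 /= add0r.
Qed.

End QuadraticExtension.

(** * An explicit tower of quadratic extensions *)

Section Model.
Variables (R : comNzRingType) (n : nat) (q : nat -> nat -> R).

Let pre m : {set 'I_n} := [set i : 'I_n | (i < m)%N].

(** A ring with relations of the Bott-Samelson shape in which independence is visible: each step
    adjoins a square root of [t], and [quadratic_free] separates the subsets that contain the new
    index from those that do not. *)
Lemma tower_model m : (m <= n)%N ->
  exists (K : comNzRingType) (iota : {rmorphism R -> K}) (x : nat -> K),
    (forall i, (i < m)%N ->
       x i ^+ 2 = (\sum_(0 <= l < i) iota (q l i) * x l) ^+ 2) /\
    (forall a : {set 'I_n} -> R,
       \sum_(A : {set 'I_n} | A \subset pre m) iota (a A) * \prod_(i in A) x i
         = 0 ->
       forall A : {set 'I_n}, A \subset pre m -> a A = 0).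
Proof.
elim: m => [|m IH] mn.
  exists R, idfun, (fun=> 0); split=> // a.
  have pre0 (A : {set 'I_n}) : (A \subset pre 0) = (A == finset.set0).
    by rewrite (_ : pre 0 = finset.set0) ?finset.subset0 //; apply/finset.setP
      => i; rewrite !inE.
  rewrite (eq_bigl _ _ pre0) big_pred1_eq big_set0 mulr1 /= => a0 A.
  by rewrite pre0 => /eqP->.
have [K [iota [x [rel free]]]] := IH (ltnW mn).
pose t := (\sum_(0 <= l < m) iota (q l m) * x l) ^+ 2.
pose h : {poly K} := 'X^2 - t%:P.
pose x' i : {poly %/ h} := if (i < m)%N then qpolyC h (x i) else in_qpoly h 'X.
exists {poly %/ h}, (qpolyC h \o iota), x'.
have x'E i : (i < m)%N -> x' i = qpolyC h (x i) by rewrite /x' => ->.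
have sumE i : (i <= m)%N -> \sum_(0 <= l < i) (qpolyC h \o iota) (q l i) * x' l
  =
    qpolyC h (\sum_(0 <= l < i) iota (q l i) * x l).
  move=> im; rewrite rmorph_sum; apply: eq_big_nat => l /andP[_ li].
  by rewrite rmorphM x'E // (leq_trans li).
split=> [i|a].
  rewrite ltnS leq_eqVlt => /orP[/eqP->|im].
    by rewrite sumE // -rmorphXn /= /x' ltnn quadratic_sqr.
  by rewrite sumE ?(ltnW im) // x'E // -!rmorphXn rel.
pose i0 : 'I_n := Ordinal mn.
have preS : pre m.+1 = (i0 |: pre m)%SET.
  by apply/finset.setP => i; rewrite !inE ltnS leq_eqVlt.
have i0pre (A : {set 'I_n}) : A \subset pre m -> i0 \notin A.
  by move=> /fintype.subsetP Am; apply/negP => /Am; rewrite inE ltnn.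
have prodE (A : {set 'I_n}) : A \subset pre m -> \prod_(i in A) x' i =
    qpolyC h (\prod_(i in A) x i).
  move=> /fintype.subsetP Am; rewrite rmorph_prod; apply: eq_bigr => i /Am.
  by rewrite inE => /x'E.
(* [u] collects the subsets avoiding the new index. [v] collects those containing it, with that
   index removed, and is the coefficient of the new generator. *)
pose u := \sum_(A : {set 'I_n} | A \subset pre m) iota (a A) * \prod_(i in A) x
  i.
pose v := \sum_(A : {set 'I_n} | A \subset pre m)
  iota (a (i0 |: A)%SET) * \prod_(i in A) x i.
have preN (A : {set 'I_n}) : (A \subset pre m.+1) && (i0 \notin A) = (A \subset
  pre m).
  apply/andP/idP => [[Am i0A]|Am]; last first.
    by rewrite preS i0pre // (fintype.subset_trans Am) ?finset.subsetUr.
  apply/fintype.subsetP => i iA; have := fintype.subsetP Am i iA; rewrite preS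
    !inE.
  by case/orP => // /eqP ii0; rewrite -ii0 iA in i0A.
have preU (A : {set 'I_n}) :
    ((i0 |: A)%SET \subset pre m.+1) && (i0 \in (i0 |: A)%SET) &&
    (((i0 |: A) :\ i0)%SET == A) = (A \subset pre m).
  rewrite finset.setU11 andbT; apply/andP/idP => [[Am /eqP AE]|Am].
    rewrite -preN -{2}AE !inE eqxx andbT.
    by rewrite (fintype.subset_trans _ Am) ?finset.subsetUr.
  by rewrite finset.setU1K ?i0pre // preS finset.setUS.
rewrite (bigID (fun A : {set 'I_n} => i0 \in A)) /= addrC.
rewrite (eq_bigl _ _ preN).
rewrite [X in _ + X](reindex_onto (fun A : {set 'I_n} => i0 |: A)%SET
                      (fun A : {set 'I_n} => A :\ i0)%SET) /=; last first.
  by move=> A /andP[_ i0A]; rewrite finset.setD1K.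
rewrite [X in _ + X](eq_bigl _ _ preU).
have -> : \sum_(A : {set 'I_n} | A \subset pre m)
    qpolyC h (iota (a A)) * \prod_(i in A) x' i = qpolyC h u.
  by rewrite rmorph_sum; apply: eq_bigr => A Am; rewrite prodE // rmorphM.
have -> : \sum_(A : {set 'I_n} | A \subset pre m)
    qpolyC h (iota (a (i0 |: A)%SET)) * \prod_(i in (i0 |: A)%SET) x' i =
    qpolyC h v * in_qpoly h 'X.
  rewrite rmorph_sum mulr_suml; apply: eq_bigr => A Am.
  rewrite big_setU1 ?i0pre //= prodE // rmorphM /=.
  by rewrite [x' i0]/x' ltnn -mulrA [in_qpoly _ _ * _]mulrC.
move=> /quadratic_free[u0 v0] A Am.
have [i0A|i0A] := boolP (i0 \in A); last first.
  by apply: (free a) => //; rewrite -preN Am.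
rewrite -(finset.setD1K i0A); apply: (free (fun A => a (i0 |: A)%SET)) => //.
by rewrite -preU !finset.setD1K // Am i0A eqxx.
Qed.

End Model.

(** * The Bott-Samelson ring *)

Section Presentation.
Variables (R : realType) (C : coxeterSystem) (n : nat) (w : n.-tuple C).
Let xb := BS_x R w.
Let sq := BS_sqfree R w.

Lemma BS_piZ (c : R) (p : mpoly n R) : BS_pi w (c *: p) = c *: BS_pi w p.
Proof. by rewrite -mul_mpolyC rmorphM. Qed.

Lemma BS_pi_eq0 (p : mpoly n R) : (BS_pi w p == 0) = (p \in BS_ideal w).
Proof. by rewrite -[p in RHS]subr0 Quotient.idealrBE -!/(BS_pi w _) raddf0. Qed.

Lemma BS_x_sqr m :
  xb m ^+ 2 = (\sum_(l < n | (l < m)%N) BS_Q R w l m *: xb l) ^+ 2.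
Proof.
have : BS_pi w (BS_q R w m) = 0.
  apply/eqP; rewrite BS_pi_eq0; apply/asboolP.
  exists (fun i => (i == m)%:R); rewrite (bigD1 m) //= eqxx mul1r big1 ?addr0
    //.
  by move=> i /negPf->; rewrite mul0r.
rewrite /BS_q rmorphB !rmorphXn /= => /eqP; rewrite subr_eq0 => /eqP->.
by rewrite raddf_sum; congr (_ ^+ 2); apply: eq_bigr => l _; exact: BS_piZ.
Qed.

(** An existential rather than a subspace, because finite dimension is established only afterwards,
    from [BS_span] and [BS_free]. *)
Definition sqfree_span (k : nat) (eta : BS R w) : Prop :=
  exists a : {ffun {set 'I_n} -> R},
    eta = \sum_(A : {set 'I_n} | #|A| == k) a A *: sq A.

Lemma sqfree_span_sum k (I : Type) (r : seq I) (P : pred I) (F : I -> BS R w) :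
  (forall i, P i -> sqfree_span k (F i)) -> sqfree_span k (\sum_(i <- r | P i)
    F i).
Proof.
move=> H; elim/big_rec: _ => [|i eta Pi [b ->]].
  by exists 0; rewrite big1 // => A _; rewrite ffunE scale0r.
have [a ->] := H i Pi; exists (a + b).
by rewrite -big_split; apply: eq_bigr => A _; rewrite ffunE scalerDl.
Qed.

Lemma sqfree_spanZ k c eta : sqfree_span k eta -> sqfree_span k (c *: eta).
Proof.
move=> [a ->]; exists [ffun A => c * a A].
by rewrite scaler_sumr; apply: eq_bigr => A _; rewrite ffunE scalerA.
Qed.

Lemma sqfree_span_sqfree (A : {set 'I_n}) : sqfree_span #|A| (sq A).
Proof.
exists [ffun B => (B == A)%:R].
rewrite (bigD1 A) //= ffunE eqxx scale1r big1 ?addr0 // => B /andP[_ /negPf BA].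
by rewrite ffunE BA scale0r.
Qed.

(** Strong induction on [i]. If [i] already occurs in the monomial, the square of [xb i] becomes a
    product of two linear forms in variables of smaller index, and the induction hypothesis applies
    to each factor in turn. *)
Lemma sqfree_span_mulx i k eta :
  sqfree_span k eta -> sqfree_span k.+1 (xb i * eta).
Proof.
have [m] := ubnP (i : nat); elim: m i k eta => // m IH i k eta im.
case=> a ->; rewrite mulr_sumr; apply: sqfree_span_sum => A /eqP Ak.
rewrite -scalerAr; apply: sqfree_spanZ.
have [iA|iA] := boolP (i \in A); last first.
  have -> : xb i * sq A = sq (i |: A)%SET by rewrite /sq /BS_sqfree big_setU1.
  have -> : k.+1 = #|(i |: A)%SET| by rewrite cardsU1 iA Ak.
  exact: sqfree_span_sqfree.
have -> : sq A = xb i * sq (A :\ i)%SET.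
  by rewrite -[in LHS](finset.setD1K iA) /sq /BS_sqfree big_setU1
    ?finset.setD11.
rewrite mulrA -expr2 BS_x_sqr expr2 -mulrA mulr_suml.
apply: sqfree_span_sum => l li; rewrite -scalerAl; apply: sqfree_spanZ.
have lm : (l < m)%N by rewrite (leq_trans li).
have {}Ak : k = #|(A :\ i)%SET|.+1 by rewrite -Ak (cardsD1 i) iA.
rewrite Ak; apply: (IH) => //.
rewrite mulr_suml; apply: sqfree_span_sum => l' l'i; rewrite -scalerAl.
apply: sqfree_spanZ; apply: (IH); last exact: sqfree_span_sqfree.
by rewrite (leq_trans l'i).
Qed.

Lemma sqfree_span_monomial (mm : multinom n) :
  sqfree_span (mdeg mm) (BS_pi w (mpolyX R mm)).
Proof.
rewrite mpolyXE_id rmorph_prod /= mdegE.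
have : forall r : seq 'I_n, sqfree_span (\sum_(i <- r) mm i)
    (\prod_(i <- r) BS_pi w (mpolyX R (mnm1 i) ^+ mm i)).
  elim=> [|i r IH].
    rewrite !big_nil -(finset.cards0 'I_n).
    have -> : 1 = sq finset.set0 by rewrite /sq /BS_sqfree big_set0.
    exact: sqfree_span_sqfree.
  rewrite !big_cons rmorphXn /=; elim: (mm i) => [|d IHd]; first by rewrite
    expr0 mul1r.
  by rewrite exprS -mulrA addSn; exact: sqfree_span_mulx.
exact.
Qed.

Lemma BS_deg_span k eta : BS_deg R w k eta -> sqfree_span k eta.
Proof.
case=> p /= /dhomogP ph <-; rewrite [p]mpolyE raddf_sum /= big_seq.
apply: sqfree_span_sum => mm /ph /= <-; rewrite BS_piZ.
by apply: sqfree_spanZ; exact: sqfree_span_monomial.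
Qed.

Lemma BS_span (eta : BS R w) :
  exists a : {ffun {set 'I_n} -> R}, eta = \sum_A a A *: sq A.
Proof.
have [p <-] : exists p, BS_pi w p = eta.
  by exists (repr eta); rewrite /BS_pi reprK.
rewrite [p]mpolyE raddf_sum /=.
elim/big_rec: _ => [|mm eta' _ [b ->]].
  by exists 0; rewrite big1 // => A _; rewrite ffunE scale0r.
rewrite BS_piZ; have [a ->] := sqfree_span_monomial mm.
exists [ffun A : {set 'I_n} => (if #|A| == mdeg mm then mcoeff mm p * a A else
  0) + b A].
under [RHS]eq_bigr do rewrite ffunE scalerDl.
rewrite [RHS]big_split /=; congr (_ + _).
rewrite big_mkcond scaler_sumr; apply: eq_bigr => A _.
by case: ifP => _; rewrite ?scalerA ?scale0r ?scaler0.
Qed.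

(** Evaluation in the ring of [tower_model] kills the ideal, so a linear relation in [BS] becomes
    one in the model, where its coefficients vanish. *)
Lemma BS_free (a : {set 'I_n} -> R) : \sum_A a A *: sq A = 0 -> forall A, a A =
  0.
Proof.
(* The matrix [BS_Q] extended by 0 to all natural indices, as the model expects. *)
pose q l m : R := if (insub l, insub m) is (Some l', Some m')
  then BS_Q R w l' m' else 0.
have [K [iota [x [rel free]]]] := tower_model q (leqnn n).
move=> a0 A.
pose ev := GRing.RMorphism.clone (mpoly n R) K (mmap iota (fun i : 'I_n => x
  i)) _.
have evX (i : 'I_n) : ev (BS_var R i) = x i.
  by rewrite /ev /BS_var /= mmapX mmap1U.
have evZ (c : R) (p : mpoly n R) : ev (c *: p) = iota c * ev p.
  exact: mmapZ.
have ev0 (p : mpoly n R) : BS_pi w p = 0 -> ev p = 0.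
  move/eqP; rewrite BS_pi_eq0 => /asboolP[b ->].
  rewrite rmorph_sum big1 // => m _; rewrite rmorphM /BS_q rmorphB !rmorphXn /=.
  rewrite evX rel // raddf_sum /= (big_nat_widen _ _ n) ?(ltnW (ltn_ord m)) //.
  rewrite big_mkord [X in X ^+ 2 - _](_ : _ =
    \sum_(l < n | (l < m)%N) ev (BS_Q R w l m *: BS_var R l)) ?subrr ?mulr0 //.
  by apply: eq_bigr => l _; rewrite evZ evX /q !valK.
apply: (free a); last first.
  by apply/fintype.subsetP => i _; rewrite inE.
transitivity (ev (\sum_A a A *: \prod_(i in A) BS_var R i)); last first.
  apply: ev0; rewrite raddf_sum -[RHS]a0; apply: eq_bigr => B _ /=.
  by rewrite BS_piZ rmorph_prod.
rewrite raddf_sum; apply: eq_big => [B|B _].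
  by apply/fintype.subsetP => i _; rewrite inE.
by rewrite /= evZ rmorph_prod; congr (_ * _); apply: eq_bigr => i _; rewrite
  evX.
Qed.

(** By [BS_free] only one family represents the element, so [xget] must return [a]. *)
Lemma BS_coordE (a : {ffun {set 'I_n} -> R}) :
  BS_coord (\sum_A a A *: sq A) = a.
Proof.
rewrite /BS_coord; case: xgetP => [b _ /= ab|]; last by move=> /(_ a) [].
apply/ffunP => A; apply/eqP; rewrite -subr_eq0; apply/eqP.
apply: (@BS_free (fun A => b A - a A)).
by under eq_bigr do rewrite scalerBl; rewrite sumrB ab subrr.
Qed.

Lemma BS_coordK (eta : BS R w) : \sum_A BS_coord eta A *: sq A = eta.
Proof. by have [a ->] := BS_span eta; rewrite BS_coordE. Qed.

Lemma BS_coord_linear (c : R) (u v : BS R w) :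
  BS_coord (c *: u + v) = [ffun A => c * BS_coord u A + BS_coord v A].
Proof.
rewrite -[u in LHS]BS_coordK -[v in LHS]BS_coordK scaler_sumr -big_split /=.
rewrite -[RHS]BS_coordE; congr BS_coord; apply: eq_bigr => A _.
by rewrite ffunE scalerDl scalerA.
Qed.

Lemma BS_vector_axiom : Vector.axiom #|{: {set 'I_n}}| (BS R w).
Proof.
exists (fun eta => \row_j BS_coord eta (enum_val j)).
  by move=> c u v; apply/rowP => j; rewrite !mxE BS_coord_linear ffunE.
exists (fun v : 'rV[R]_#|{: {set 'I_n}}| => \sum_A v 0 (enum_rank A) *: sq A).
  move=> eta; rewrite -[RHS]BS_coordK; apply: eq_bigr => A _.
  by rewrite mxE enum_rankK.
move=> v; apply/rowP => j; rewrite mxE.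
have -> : \sum_A v 0 (enum_rank A) *: sq A =
    \sum_A [ffun A => v 0 (enum_rank A)] A *: sq A.
  by apply: eq_bigr => A _; rewrite ffunE.
by rewrite BS_coordE ffunE enum_valK.
Qed.

Lemma BS_degmap_scalar : scalar (@BS_degmap R C n w).
Proof. by move=> c u v; rewrite /BS_degmap BS_coord_linear ffunE. Qed.

Lemma BS_degmap_top : BS_degmap (sq [set: 'I_n]%SET) = 1.
Proof.
have -> : sq [set: 'I_n]%SET = \sum_A [ffun A => (A == [set: 'I_n]%SET)%:R] A
  *: sq A.
  rewrite (bigD1 [set: 'I_n]%SET) //= ffunE eqxx scale1r big1 ?addr0 // => A.
  by move=> /negPf AT; rewrite ffunE AT scale0r.
by rewrite /BS_degmap BS_coordE ffunE eqxx.
Qed.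

End Presentation.

HB.instance Definition _ (R : realType) (C : coxeterSystem) (n : nat)
  (w : n.-tuple C) := Lmodule_hasFinDim.Build R (BS R w) (BS_vector_axiom R w).

HB.instance Definition _ (R : realType) (C : coxeterSystem) (n : nat)
  (w : n.-tuple C) := GRing.isLinear.Build R (BS R w) R *%R
    (@BS_degmap R C n w) (@BS_degmap_scalar R C n w).

(** * The Bott-Samelson ring as an instance of the tower *)

Section Main.
Variables (R : realType) (C : coxeterSystem) (n : nat) (w : n.-tuple C).

Let T : ComVAlgebra.type R := BS R w.

(** The tower is indexed by natural numbers; from [n] on the default is 0. *)
Definition BS_xnat (i : nat) : T := if insub i is Some j then BS_x R w j else 0.

Definition BS_L (m : nat) : T :=
  if insub m is Some j then \sum_(l < n | (l < m)%N) BS_Q R w l j *: BS_x R w l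
  else 0.

Local Notation graded := (@graded R T BS_xnat).

Lemma BS_xnatE (i : 'I_n) : BS_xnat i = BS_x R w i.
Proof. by rewrite /BS_xnat valK. Qed.

Lemma BS_L_graded m : (m < n)%N -> BS_L m \in graded m 1.
Proof.
move=> mn; rewrite /BS_L insubT /=; apply: rpred_sum => l lm.
by rewrite rpredZ // -BS_xnatE graded_x.
Qed.

Lemma BS_xL m : (m < n)%N -> BS_xnat m ^+ 2 = BS_L m ^+ 2.
Proof. by move=> mn; rewrite /BS_xnat /BS_L insubT /= BS_x_sqr. Qed.

Lemma BS_top : BS_degmap (\prod_(0 <= i < n) BS_xnat i) = 1.
Proof.
rewrite -(BS_degmap_top R w) big_mkord /BS_sqfree; congr BS_degmap.
by apply: eq_big => [i|i _]; rewrite ?finset.inE ?BS_xnatE.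
Qed.

(** One direction expands in squarefree monomials. The other follows the recursion of [graded],
    lifting each component to a homogeneous polynomial. *)
Lemma BS_degE k eta : BS_deg R w k eta <-> eta \in graded n k.
Proof.
split.
  move/BS_deg_span => [a ->]; apply: rpred_sum => A /eqP <-.
  apply: rpredZ; rewrite /BS_sqfree -(big_enum _ _ _ (BS_x R w)) /= cardE.
  elim: (enum A) => [|i r IH]; first by rewrite big_nil graded1.
  rewrite big_cons /= -add1n; apply: (graded_mul BS_L_graded BS_xL) => //.
  by rewrite -BS_xnatE graded_x.
suff H m : (m <= n)%N -> forall k eta, eta \in graded m k -> BS_deg R w k eta.
  exact: H.
elim: m {k eta} => [|m IH] mn k eta.
  case: k => [|k] /=; last first.
    rewrite memv0 => /eqP->; exists 0; last exact: raddf0.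
    exact: dhomog0.
  case/vlineP=> c ->; exists (c *: 1); last by rewrite BS_piZ rmorph1.
  by apply: dhomogZ; exact: dhomog1.
case/mem_gradedS => a [b [/(IH (ltnW mn))[p ph <-] bG ->]].
have [q qh <-] : exists2 q : mpoly n R, q \is ishomog1 k mdeg & BS_pi w q = b *
  BS_xnat m.
  case: k bG {p ph} => [|k] /=.
    by rewrite memv0 => /eqP->; exists 0; [exact: dhomog0|rewrite mul0r raddf0].
  case/(IH (ltnW mn)) => q qh <-; exists (q * BS_var R (Ordinal mn)).
    by rewrite -addn1; apply: dhomogM => //; rewrite dhomogX /= mdeg1.
  by rewrite rmorphM /=; congr (_ * _); rewrite -[m in RHS]/(val (Ordinal mn))
    BS_xnatE.
exists (p + q); last exact: raddfD.
exact: dhomogD.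
Qed.

End Main.

Theorem theorem1p2 (R : realType) (C : coxeterSystem) (n : nat)
    (w : n.-tuple C) :
  exists c : 'I_n -> R, (forall i, 0 < c i) /\
  let ell : BS R w := \sum_i c i *: BS_x R w i in
  [/\ (* Poincare duality *)
      forall k : nat, (k.*2 <= n)%N ->
        nondegenerate_on (BS_deg R w k) (BS_deg R w (n - k))
          (fun eta1 eta2 => BS_degmap (eta1 * eta2)),
      (* Hard Lefschetz *)
      forall k : nat, (k.*2 <= n)%N ->
        set_bij (BS_deg R w k) (BS_deg R w (n - k))
          (fun eta => ell ^+ (n - k.*2) * eta)
    & (* Hodge-Riemann relations *)
      forall k : nat, (k.*2 <= n)%N ->
        posdef_on (BS_prim ell k)
          (fun eta1 eta2 =>
             (-1) ^+ k * BS_degmap (ell ^+ (n - k.*2) * eta1 * eta2))].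
Proof.
have LG := @BS_L_graded R C n w; have xL := @BS_xL R C n w; have top := BS_top
  R w.
have [c [c0 HR]] := hodge_riemann_exists LG xL top (leqnn n).
exists (fun i : 'I_n => c i); split=> [i|]; first exact: c0.
move=> ell.
have ellE : ell = \sum_(0 <= i < n) c i *: BS_xnat R w i.
  by rewrite big_mkord; apply: eq_bigr => i _; rewrite BS_xnatE.
rewrite -{}ellE in HR.
have ellG : ell \in graded (BS_xnat R w) n 1.
  by apply: rpred_sum => i _; rewrite rpredZ // -BS_xnatE graded_x.
(* At the top of the tower the complementary product is empty, so the form is the degree map
   itself. *)
have yn : cotop (BS_xnat R w) n n = 1 by rewrite /cotop big_geq.
have PD k u : BS_deg R w k u ->
    (forall v, BS_deg R w (n - k) v -> BS_degmap (u * v) = 0) -> u = 0.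
  move=> /BS_degE uG H.
  apply: (graded_pairing_nondegenerate LG xL top (leqnn n) uG) => v /BS_degE vG.
  by rewrite yn mulr1 /= H.
split=> k kn.
- have kn' : (k <= n)%N by lia.
  split=> [u uG H|v vG H]; first exact: PD uG H.
  (* The second half of non-degeneracy is [PD] in degree [n - k], by commutativity and
     [n - (n - k) = k]. *)
  by apply: (PD _ v vG) => u; rewrite subKn // mulrC => /H.
- split.
  + move=> u /= /BS_degE uG; apply/BS_degE.
    rewrite (_ : n - k = (n - k.*2) + k)%N; last by lia.
    by apply: (graded_mul LG xL) => //; exact: (graded_exp LG xL).
  + move=> u v /set_mem /BS_degE uG /set_mem /BS_degE vG uv.
    apply/eqP; rewrite -subr_eq0; apply/eqP.
    apply: (lefschetz_inj HR kn); first exact: rpredB.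
    by rewrite mulrBr uv subrr.
  + move=> v /BS_degE vG.
    have [u uG ->] := lefschetz_surj LG xL top (leqnn n) ellG HR kn vG.
    by exists u => //; apply/BS_degE.
- move=> u [/BS_degE uG u0] un0.
  by have := HR k u kn uG u0 un0; rewrite yn mulr1.
Qed.
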